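(* There exist a continuous function $h:\mathbb{R}\to\mathbb{R}$ and a bounded analytic domain $\Omega\subset\mathbb{R}^2$, which is convex in $x$ and symmetric about the vertical axis $H_0=\{(0,y): y\in\mathbb{R}\}$, such that the problem $$\Delta u+4u+h(y)=0,\quad (x,y)\in\Omega,\qquad u=0,\quad (x,y)\in\partial\Omega,$$ has a nonnegative solution $u$ whose nodal set in $\Omega$ consists of two analytic curves.
   Context: Points of $\mathbb{R}^2$ are written $(x,y)$, and $\Delta=\partial_x^2+\partial_y^2$. A solution $u$ of the problem is understood in the classical sense: $u\in C^2(\Omega)\cap C(\overline{\Omega})$, the equation holds pointwise in $\Omega$ and $u=0$ on $\partial\Omega$. A domain is a nonempty connected open set. An analytic domain is a Lipschitz domain whose boundary is an analytic submanifold of $\mathbb{R}^2$. A domain $\Omega$ is convex in $x$ if, whenever $(x_1,y),(x_2,y)\in\Omega$, the whole horizontal segment joining them lies in $\Omega$. It is symmetric about $H_0$ if $(x,y)\in\Omega$ implies $(-x,y)\in\Omega$. The nodal set of $u$ in $\Omega$ is $\{(x,y)\in\Omega: u(x,y)=0\}$. A curve is a one-dimensional submanifold of $\mathbb{R}^2$, possibly with boundary; it is analytic if this submanifold is real-analytic. *)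

(* Defs.v *)
From mathcomp Require Import all_boot all_order all_algebra.
From mathcomp Require Import all_classical all_reals all_analysis.

Set Implicit Arguments.
Unset Strict Implicit.
Unset Printing Implicit Defensive.

Import Order.TTheory GRing.Theory Num.Theory.
Import numFieldNormedType.Exports.

Local Open Scope classical_set_scope.
Local Open Scope ring_scope.

Section PlaneSetsAndFunctions.
Context {R : realType}.
Implicit Types (f u s t : R * R -> R) (p q : R * R) (U M Om : set (R * R)).

Definition dx f : R * R -> R := 'D_((1, 0) : R * R) f.
Definition dy f : R * R -> R := 'D_((0, 1) : R * R) f.

Definition has_partials f p : Prop :=
  derivable f p ((1, 0) : R * R) /\ derivable f p ((0, 1) : R * R).

Definition laplacian u p : R := dx (dx u) p + dy (dy u) p.

(* [C1_on] and [C2_on] are meant for open sets: the values of the partial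
   derivatives on an open set only depend on the function on that set. *)
Definition C1_on U f : Prop :=
  forall p, U p ->
    [/\ {for p, continuous f}, has_partials f p,
        {for p, continuous (dx f)} & {for p, continuous (dy f)}].

Definition C2_on U f : Prop := [/\ C1_on U f, C1_on U (dx f) & C1_on U (dy f)].

(* Near [p], [f] is the sum of an absolutely convergent double power series;
   absolute convergence makes the square partial sums used here equivalent to
   any other summation order. *)
Definition analytic_at f p : Prop :=
  exists (a : nat -> nat -> R) (r : R), 0 < r /\
    forall x y : R, `|x - p.1| < r -> `|y - p.2| < r ->
      cvgn (fun n => \sum_(i < n) \sum_(j < n)
                       `|a i j * (x - p.1) ^+ i * (y - p.2) ^+ j|) /\
      (fun n => \sum_(i < n) \sum_(j < n)
                  a i j * (x - p.1) ^+ i * (y - p.2) ^+ j) @ \oo --> f (x, y).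

Definition analytic_on U f : Prop := forall p, U p -> analytic_at f p.

(* By the analytic inverse function theorem, [q |-> (s q, t q)] is then an
   analytic diffeomorphism of [U] onto an open subset of the plane. *)
Definition analytic_coordinates U s t : Prop :=
  [/\ open U,
      analytic_on U s /\ analytic_on U t,
      {in U &, injective (fun q => (s q, t q))} &
      forall q, U q -> dx s q * dy t q - dy s q * dx t q != 0].

(* One-dimensional submanifolds: in suitable local coordinates [(s, t)] the set
   is the axis [t = 0] or, at the boundary of the submanifold, the half-axis
   [t = 0], [0 <= s]. *)
Definition analytic_submanifold1 M : Prop :=
  forall p, M p -> exists U s t,
    [/\ U p, analytic_coordinates U s t & M `&` U = U `&` [set q | t q = 0]].

Definition analytic_submanifold1_with_boundary M : Prop :=
  forall p, M p -> exists U s t,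
    [/\ U p, analytic_coordinates U s t &
        M `&` U = U `&` [set q | t q = 0] \/
        M `&` U = U `&` [set q | t q = 0 /\ 0 <= s q]].

Definition analytic_curve M : Prop :=
  [/\ M !=set0, connected M & analytic_submanifold1_with_boundary M].

Definition boundary Om : set (R * R) := closure Om `\` interior Om.

Definition domain Om : Prop := [/\ open Om, Om !=set0 & connected Om].

(* Near each boundary point the domain is the strict epigraph of a Lipschitz
   function in Cartesian coordinates rotated by the angle with cosine [c] and
   sine [s]. *)
Definition lipschitz_domain Om : Prop :=
  domain Om /\
  forall p, boundary Om p ->
    exists (U : set (R * R)) (c s : R) (g : R -> R),
      [/\ open U, U p, c ^+ 2 + s ^+ 2 = 1, lipschitz g &
          Om `&` U =
            U `&` [set q | g (c * q.1 + s * q.2) < - s * q.1 + c * q.2]].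

Definition analytic_domain Om : Prop :=
  lipschitz_domain Om /\ analytic_submanifold1 (boundary Om).

Definition convex_in_x Om : Prop :=
  forall x1 x2 y : R, Om (x1, y) -> Om (x2, y) ->
    forall x : R, x1 <= x <= x2 -> Om (x, y).

Definition symmetric_about_H0 Om : Prop :=
  forall x y : R, Om (x, y) -> Om (- x, y).

Definition nodal_set Om u : set (R * R) := Om `&` [set p | u p = 0].

Definition classical_solution (h : R -> R) Om u : Prop :=
  [/\ C2_on Om u, {within closure Om, continuous u},
      (forall p, Om p -> laplacian u p + 4 * u p + h p.2 = 0) &
      (forall p, boundary Om p -> u p = 0)].

(* Separatedness makes [C1] and [C2] the connected components of [N]; without
   it a single arc, cut in two, would qualify. *)
Definition consists_of_two_analytic_curves (N : set (R * R)) : Prop :=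
  exists C1 C2 : set (R * R),
    [/\ analytic_curve C1, analytic_curve C2, separated C1 C2 &
        N = C1 `|` C2].

End PlaneSetsAndFunctions.

(* Main.v *)
Require Import Defs.
From mathcomp Require Import all_boot all_order all_algebra.
From mathcomp Require Import all_classical all_reals all_analysis.
From mathcomp Require Import ring lra.
Import Order.TTheory GRing.Theory Num.Theory.
Import numFieldNormedType.Exports.
Local Open Scope classical_set_scope.
Local Open Scope ring_scope.

(** As [h] is an arbitrary continuous function, it suffices to find [u] such
    that [Delta u + 4 u] does not depend on [x].  Put [s = ky y],
    [c = cos (kx x)] and [E = 4 cos (2 s) - 1] with [kx ^ 2 = 8 / 33] and
    [ky ^ 2 = 4 / 33], and let [u = cos s (10 c ^ 2 - E ^ 2) ^ 2].  Since
    [cos s (E ^ 2 - 5) = 4 cos (5 s)], the part of [u] that depends on [x] is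
    [25/2 cos s cos (4 kx x) - 40 cos (5 s) cos (2 kx x)], and both of its terms
    solve [Delta w + 4 w = 0].  Now [u = cos s (P N) ^ 2] with
    [P = sqrt 10 c + E] and [N = sqrt 10 c - E].  The domain is the cell of
    [P > 0] around the origin.  Its boundary is smooth because [P] has no
    critical zero there, even at the four points [c = E = 0] where the curves
    [N = 0] reach it.  In that cell [u] vanishes where [sqrt 10 c = E > 0], on the pair
    of arcs [x = +- arccos (E / sqrt 10) / kx]. *)

Set Implicit Arguments.
Unset Strict Implicit.

(** * Trigonometric polynomials in two variables: derivatives and Laplacian *)

Section TrigonometricPolynomials.
Context {R : realType}.
Implicit Types (p : R * R) (m : R * (R * R) * (R * R)).
Implicit Types l : seq (R * (R * R) * (R * R)).

Definition wave m p : R :=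
  m.1.1 * cos (m.1.2.1 * p.1 + m.1.2.2) * cos (m.2.1 * p.2 + m.2.2).

(** The modes are kept as data, so that differentiation becomes a [map] and the eigenvalues of the
    Laplacian can be read off the frequencies. *)
Definition trigpoly l p : R := \sum_(m <- l) wave m p.

(* A shift of the phase by [pi / 2] makes trigonometric polynomials closed
   under differentiation without introducing sines. *)
Definition wave_dx m : R * (R * R) * (R * R) :=
  (m.1.1 * m.1.2.1, (m.1.2.1, m.1.2.2 + pi / 2), m.2).

Definition wave_dy m : R * (R * R) * (R * R) :=
  (m.1.1 * m.2.1, m.1.2, (m.2.1, m.2.2 + pi / 2)).

Lemma is_derive_affine_cos (a b x : R) :
  is_derive x 1 (fun z => cos (a * z + b)) (a * cos (a * x + b + pi / 2)).
Proof.
rewrite cosDpihalf; apply: is_derive_eq.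
by rewrite /GRing.scale /=; ring.
Qed.

(** Along [(1, 0)] the difference quotient of [fun q => f q.1] is convertible to the one-variable
    quotient of [f]. *)
Lemma is_derive_fst (f : R -> R) (df : R) p :
  is_derive p.1 1 f df -> is_derive p ((1, 0) : R * R) (fun q => f q.1) df.
Proof. by case=> d e; split. Qed.

Lemma is_derive_snd (f : R -> R) (df : R) p :
  is_derive p.2 1 f df -> is_derive p ((0, 1) : R * R) (fun q => f q.2) df.
Proof. by case=> d e; split. Qed.

(** The shift leaves the first coordinate alone, so the difference quotient vanishes identically,
    whatever [f] is. *)
Lemma is_derive_fst0 (f : R -> R) p :
  is_derive p ((0, 1) : R * R) (fun q => f q.1) 0.
Proof.
have h : (fun h : R => h^-1 *: (((fun q : R * R => f q.1) \o shift p)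
   (h *: ((0, 1) : R * R)) - f p.1)) = cst 0.
  by apply/funext => h /=; rewrite scaler0 add0r subrr scaler0.
by split; rewrite ?/derivable ?/derive h; [exact: is_cvg_cst|exact: lim_cst].
Qed.

Lemma is_derive_snd0 (f : R -> R) p :
  is_derive p ((1, 0) : R * R) (fun q => f q.2) 0.
Proof.
have h : (fun h : R => h^-1 *: (((fun q : R * R => f q.2) \o shift p)
   (h *: ((1, 0) : R * R)) - f p.2)) = cst 0.
  by apply/funext => h /=; rewrite scaler0 add0r subrr scaler0.
by split; rewrite ?/derivable ?/derive h; [exact: is_cvg_cst|exact: lim_cst].
Qed.

Lemma waveE m : wave m =
  (cst m.1.1 * (fun q : R * R => cos (m.1.2.1 * q.1 + m.1.2.2))) *
  (fun q : R * R => cos (m.2.1 * q.2 + m.2.2)).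
Proof. by []. Qed.

Lemma is_derive_wave_x m p :
  is_derive p ((1, 0) : R * R) (wave m) (wave (wave_dx m) p).
Proof.
have d1 := is_derive_fst (is_derive_affine_cos m.1.2.1 m.1.2.2 p.1).
have d2 := is_derive_snd0 (fun y => cos (m.2.1 * y + m.2.2)) p.
rewrite waveE; apply: is_derive_eq.
by rewrite /GRing.scale /wave /= !fctE !addrA; ring.
Qed.

Lemma is_derive_wave_y m p :
  is_derive p ((0, 1) : R * R) (wave m) (wave (wave_dy m) p).
Proof.
have d1 := is_derive_fst0 (fun y => cos (m.1.2.1 * y + m.1.2.2)) p.
have d2 := is_derive_snd (is_derive_affine_cos m.2.1 m.2.2 p.2).
rewrite waveE; apply: is_derive_eq.
by rewrite /GRing.scale /wave /= !fctE !addrA; ring.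
Qed.

Lemma trigpoly_nil : trigpoly [::] = cst 0.
Proof. by apply/funext => q; rewrite /trigpoly big_nil. Qed.

Lemma trigpoly_cons m l : trigpoly (m :: l) = wave m + trigpoly l.
Proof. by apply/funext => q; rewrite /trigpoly big_cons. Qed.

Lemma is_derive_trigpoly_x l p :
  is_derive p ((1, 0) : R * R) (trigpoly l) (trigpoly (map wave_dx l) p).
Proof.
elim: l => [|m l IH] /=; first by rewrite trigpoly_nil; exact: is_derive_cst.
by rewrite !trigpoly_cons; apply: is_deriveD; exact: is_derive_wave_x.
Qed.

Lemma is_derive_trigpoly_y l p :
  is_derive p ((0, 1) : R * R) (trigpoly l) (trigpoly (map wave_dy l) p).
Proof.
elim: l => [|m l IH] /=; first by rewrite trigpoly_nil; exact: is_derive_cst.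
by rewrite !trigpoly_cons; apply: is_deriveD; exact: is_derive_wave_y.
Qed.

Lemma dx_trigpoly l : dx (trigpoly l) = trigpoly (map wave_dx l).
Proof. by apply/funext => p; have [] := is_derive_trigpoly_x l p. Qed.

Lemma dy_trigpoly l : dy (trigpoly l) = trigpoly (map wave_dy l).
Proof. by apply/funext => p; have [] := is_derive_trigpoly_y l p. Qed.

Lemma continuous_affine_cos (a b : R) : continuous (fun z => cos (a * z + b)).
Proof.
move=> x; apply/differentiable_continuous/derivable1_diffP.
by have [] := is_derive_affine_cos a b x.
Qed.

Lemma continuous_wave m : continuous (wave m).
Proof.
move=> p; rewrite waveE; apply: continuousM; last first.
  apply: (@continuous_comp _ _ _ snd (fun y => cos (m.2.1 * y + m.2.2))).
    exact: cvg_snd.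
  exact: continuous_affine_cos.
apply: continuousM; first exact: cvg_cst.
apply: (@continuous_comp _ _ _ fst (fun x => cos (m.1.2.1 * x + m.1.2.2))).
  exact: cvg_fst.
exact: continuous_affine_cos.
Qed.

Lemma continuous_trigpoly l : continuous (trigpoly l).
Proof.
elim: l => [|m l IH] p; first by rewrite trigpoly_nil; exact: cvg_cst.
rewrite trigpoly_cons; apply: continuousD; [exact: continuous_wave|exact: IH].
Qed.

Lemma C1_on_trigpoly U l : C1_on U (trigpoly l).
Proof.
move=> p _; rewrite dx_trigpoly dy_trigpoly; split.
- exact: continuous_trigpoly.
- by split; [case: (is_derive_trigpoly_x l p)|case: (is_derive_trigpoly_y l p)].
- exact: continuous_trigpoly.
- exact: continuous_trigpoly.
Qed.

Lemma C2_on_trigpoly U l : C2_on U (trigpoly l).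
Proof.
by rewrite /C2_on dx_trigpoly dy_trigpoly; split; exact: C1_on_trigpoly.
Qed.

(** Two phase shifts by [pi / 2] change the sign of a cosine. *)
Lemma laplacian_wave m p :
  wave (wave_dx (wave_dx m)) p + wave (wave_dy (wave_dy m)) p =
  - (m.1.2.1 ^+ 2 + m.2.1 ^+ 2) * wave m p.
Proof. by rewrite /wave /= !addrA !cosDpihalf !sinDpihalf; ring. Qed.

Lemma laplacian_trigpoly l p : laplacian (trigpoly l) p =
  \sum_(m <- l) - (m.1.2.1 ^+ 2 + m.2.1 ^+ 2) * wave m p.
Proof.
rewrite /laplacian !(dx_trigpoly, dy_trigpoly) -!map_comp.
rewrite /trigpoly !big_map -big_split /=.
by apply: eq_bigr => m _; exact: laplacian_wave.
Qed.

End TrigonometricPolynomials.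

(** * Power series expansions of trigonometric polynomials *)

Section Analyticity.
Context {R : realType}.
Implicit Types (F G : R -> R) (p : R * R) (f g : R * R -> R).

(** Convergence is asked for every increment [h], so that the radius in [analytic_at] can be chosen
    freely. *)
Definition entire_at F (x0 : R) : Prop := exists c : nat -> R, forall h : R,
  cvgn (series (fun i => `|c i * h ^+ i|)) /\
  series (fun i => c i * h ^+ i) @ \oo --> F (x0 + h).

Lemma norm_cos_coeff_le (x : R) n : `|cos_coeff x n| <= exp_coeff `|x| n.
Proof.
rewrite /exp_coeff /cos_coeff /= !normrM normfV !normr_nat !normrX normrN normr1.
rewrite expr1n mulr1 ler_wpM2r ?invr_ge0// ler_piMl ?exprn_ge0//.
by rewrite lern1 leq_b1.
Qed.

Lemma norm_sin_coeff_le (x : R) n : `|sin_coeff x n| <= exp_coeff `|x| n.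
Proof.
rewrite /exp_coeff /sin_coeff /= !normrM normfV !normr_nat !normrX normrN normr1.
rewrite expr1n mulr1 ler_wpM2r ?invr_ge0// ler_piMl ?exprn_ge0//.
by rewrite lern1 leq_b1.
Qed.

(** With [A = a * x0 + b], the addition formula for [cos (A + a * h)] combines the cosine and sine
    series in [a * h]; the exponential series dominates both. *)
Lemma entire_at_affine_cos (a b x0 : R) : entire_at (fun x => cos (a * x + b)) x0.
Proof.
set A := a * x0 + b.
pose cc i : R := (~~ odd i)%:R * (-1) ^+ i./2 * (i`!%:R)^-1.
pose sc i : R := (odd i)%:R * (-1) ^+ i.-1./2 * (i`!%:R)^-1.
exists (fun i => (cos A * cc i - sin A * sc i) * a ^+ i) => h.
have E i : (cos A * cc i - sin A * sc i) * a ^+ i * h ^+ i =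
    cos A * cos_coeff (a * h) i - sin A * sin_coeff (a * h) i.
  by rewrite cos_coeffE sin_coeffE /= exprMn /cc /sc; ring.
rewrite (funext E); split.
  have ex := is_cvg_series_exp_coeff `|a * h|.
  apply: (@series_le_cvg _ _ (exp_coeff `|a * h| + exp_coeff `|a * h|)) => //.
  - by move=> n; rewrite fctE addr_ge0 // /exp_coeff /= divr_ge0.
  - move=> n /=; rewrite E (le_trans (ler_normB _ _))// lerD// normrM.
      exact: le_trans (ler_piMl _ (cos_max _)) (norm_cos_coeff_le _ _).
    exact: le_trans (ler_piMl _ (sin_max _)) (norm_sin_coeff_le _ _).
  - by apply: is_cvg_seriesD.
rewrite mulrDr -addrA (addrC _ b) addrA -/A.
rewrite [X in X @ _](_ : _ = fun n => cos A * series (cos_coeff (a * h)) n -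
    sin A * series (sin_coeff (a * h)) n); last first.
  by apply/funext => n; rewrite /series /= !mulr_sumr -sumrB.
have cvc : series (cos_coeff (a * h)) @ \oo --> cos (a * h).
  by rewrite cos.unlock; exact: is_cvg_series_cos_coeff.
have cvs : series (sin_coeff (a * h)) @ \oo --> sin (a * h).
  by rewrite sin.unlock; exact: is_cvg_series_sin_coeff.
rewrite (cosD A (a * h)); exact: (cvgB (cvgMl_tmp cvc) (cvgMl_tmp cvs)).
Qed.

Lemma entire_at_id (x0 : R) : entire_at id x0.
Proof.
exists (fun i => if i is i'.+1 then (i' == 0%N)%:R else x0) => h; split.
  (* Partial sums with at least two terms are constant; the shift by 2 skips the shorter ones. *)
  apply/cvg_ex; exists (`|x0| + `|h|); rewrite seriesEord -(cvg_shiftn 2%N) /=.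
  rewrite [X in X @ _](_ : _ = cst (`|x0| + `|h|)); first exact: cvg_cst.
  apply/funext => n; rewrite addn2 !big_ord_recl /= expr0 expr1 mulr1 mul1r.
  by rewrite big1 ?addr0// => i _; rewrite mul0r normr0.
rewrite seriesEord -(cvg_shiftn 2%N) /=.
rewrite [X in X @ _](_ : _ = cst (x0 + h)); first exact: cvg_cst.
apply/funext => n; rewrite addn2 !big_ord_recl /= expr0 expr1 mulr1 mul1r.
by rewrite big1 ?addr0// => i _; rewrite mul0r.
Qed.

Lemma entire_at_cst (k x0 : R) : entire_at (fun=> k) x0.
Proof.
exists (fun i => if i is 0%N then k else 0) => h; split.
  apply/cvg_ex; exists `|k|; rewrite seriesEord -(cvg_shiftn 1%N) /=.
  rewrite [X in X @ _](_ : _ = cst `|k|); first exact: cvg_cst.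
  apply/funext => n; rewrite addn1 big_ord_recl /= expr0 mulr1.
  by rewrite big1 ?addr0// => i _; rewrite mul0r normr0.
rewrite seriesEord -(cvg_shiftn 1%N) /=.
rewrite [X in X @ _](_ : _ = cst k); first exact: cvg_cst.
apply/funext => n; rewrite addn1 big_ord_recl /= expr0 mulr1.
by rewrite big1 ?addr0// => i _; rewrite mul0r.
Qed.

(** For product coefficients, a square partial sum factors into two one-variable partial sums. *)
Lemma analytic_at_tensor F G p : entire_at F p.1 -> entire_at G p.2 ->
  analytic_at (fun q => F q.1 * G q.2) p.
Proof.
move=> [c hc] [d hd]; exists (fun i j => c i * d j), 1; split=> // x y _ _.
have [] := hc (x - p.1); have [] := hd (y - p.2).
rewrite !seriesEord /= => da dG ca cF.
have E i j : c i * d j * (x - p.1) ^+ i * (y - p.2) ^+ j =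
  (c i * (x - p.1) ^+ i) * (d j * (y - p.2) ^+ j) by ring.
split.
  under eq_fun do under eq_bigr do under eq_bigr do rewrite E normrM.
  under eq_fun do rewrite -big_distrlr /=.
  exact: is_cvgM.
under eq_fun do under eq_bigr do under eq_bigr do rewrite E.
under eq_fun do rewrite -big_distrlr /=.
rewrite /= [x in F x](_ : x = p.1 + (x - p.1)) ?[y in G y](_ : y = p.2 + (y - p.2)).
  exact: cvgM.
all: ring.
Qed.

Lemma analytic_atD f g p : analytic_at f p -> analytic_at g p ->
  analytic_at (f + g) p.
Proof.
move=> [a [r [r0 ha]]] [b [s [s0 hb]]].
exists (fun i j => a i j + b i j), (Num.min r s); split.
  by rewrite lt_min r0.
move=> x y; rewrite !lt_min => /andP[xr xs] /andP[yr ys].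
have [ca cf] := ha x y xr yr; have [cb cg] := hb x y xs ys.
split; last first.
  under eq_fun do under eq_bigr do under eq_bigr do rewrite !mulrDl.
  under eq_fun do under eq_bigr do rewrite big_split.
  under eq_fun do rewrite big_split.
  exact: cvgD.
(* Absolute convergence: the partial sums increase and, by the triangle inequality, stay below the
   sum of the two given limits. *)
apply: nondecreasing_is_cvgn.
  apply/nondecreasing_seqP => n; rewrite big_ord_recr /= ler_wpDr ?sumr_ge0//.
  by apply: ler_sum => i _; rewrite big_ord_recr /= ler_wpDr.
have nd (c : nat -> nat -> R) : nondecreasing_seq (fun n =>
    \sum_(i < n) \sum_(j < n) `|c i j * (x - p.1) ^+ i * (y - p.2) ^+ j|).
  apply/nondecreasing_seqP => n; rewrite big_ord_recr /= ler_wpDr ?sumr_ge0//.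
  by apply: ler_sum => i _; rewrite big_ord_recr /= ler_wpDr.
eexists => _ [n _ <-].
apply: le_trans (lerD (nondecreasing_cvgn_le (nd a) ca n)
                      (nondecreasing_cvgn_le (nd b) cb n)).
rewrite -big_split ler_sum// => i _; rewrite -big_split ler_sum// => j _ /=.
by rewrite !mulrDl ler_normD.
Qed.

Lemma analytic_at_fst p : analytic_at fst p.
Proof.
rewrite [fst](_ : _ = fun q : R * R => id q.1 * (fun=> 1) q.2).
  exact: analytic_at_tensor (entire_at_id _) (entire_at_cst _ _).
by apply/funext => q; rewrite mulr1.
Qed.

Lemma analytic_at_snd p : analytic_at snd p.
Proof.
rewrite [snd](_ : _ = fun q : R * R => (fun=> 1) q.1 * id q.2).
  exact: analytic_at_tensor (entire_at_cst _ _) (entire_at_id _).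
by apply/funext => q; rewrite mul1r.
Qed.

Lemma analytic_at_trigpoly l p : analytic_at (trigpoly l) p.
Proof.
elim: l => [|m l IH].
  rewrite trigpoly_nil [cst _](_ : _ = fun q : R * R => (fun=> 0) q.1 * (fun=> 1) q.2).
    exact: analytic_at_tensor (entire_at_cst 0 _) (entire_at_cst 1 _).
  by apply/funext => q; rewrite mul0r.
rewrite trigpoly_cons; apply: analytic_atD => //.
apply: (@analytic_at_tensor (fun x => m.1.1 * cos (m.1.2.1 * x + m.1.2.2))
  (fun y => cos (m.2.1 * y + m.2.2))); last exact: entire_at_affine_cos.
have [c hc] := entire_at_affine_cos m.1.2.1 m.1.2.2 p.1.
exists (fun i => m.1.1 * c i) => h; have [ca cc] := hc h; split.
  rewrite [X in series X](_ : _ = `|m.1.1| *: (fun i => `|c i * h ^+ i|)).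
    exact: is_cvg_seriesZ.
  by apply/funext => i; rewrite -mulrA normrM.
under eq_fun do rewrite -mulrA.
rewrite [series _](_ : _ = fun n => m.1.1 * series (fun i => c i * h ^+ i) n).
  exact: (cvgMl_tmp cc).
by apply/funext => n; rewrite /series /= mulr_sumr.
Qed.

End Analyticity.

(** * Level curves as Lipschitz graphs of inverse cosines *)

Section InverseCosineGraphs.
Context {R : realType}.

Lemma cos_mul_norm (a x : R) : cos (a * `|x|) = cos (a * x).
Proof. by case: (ler0P x) => _ //; rewrite mulrN cosN. Qed.

Lemma cos_dist_le (x y : R) : `|cos x - cos y| <= `|x - y|.
Proof.
wlog yx : x y / y <= x.
  move=> H; case/orP: (le_total y x) => /H //.
  by rewrite distrC (distrC y).
have [|c _ ->] := @MVT_segment R cos (fun z => - sin z) y x yx.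
- by apply: continuous_subspaceT; exact: continuous_cos.
- by rewrite normrM normrN ler_piMl// sin_max.
Qed.

(** Mean value theorem: on [[-r, r]] the derivative of [acos] is largest in size at the
    endpoints. *)
Lemma acos_dist_le (r x y : R) : r < 1 -> -r <= x <= r -> -r <= y <= r ->
  `|acos x - acos y| <= (Num.sqrt (1 - r ^+ 2))^-1 * `|x - y|.
Proof.
move=> r1; wlog yx : x y / y <= x.
  move=> H xr yr; case/orP: (le_total y x) => /H; first exact.
  by rewrite distrC (distrC y); exact.
move=> xr yr.
have dacos z : -r <= z <= r -> is_derive z 1 (@acos R) (- (Num.sqrt (1 - z ^+ 2))^-1).
  by move=> zr; apply: is_derive1_acos; lra.
have [z||c] := @MVT_segment R (@acos R) (fun z => - (Num.sqrt (1 - z ^+ 2))^-1) y x yx.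
- by rewrite in_itv /= => zxy; apply: dacos; lra.
- apply: continuous_in_subspaceT => z; rewrite inE /= in_itv /= => zxy.
  by apply: continuous_acos; lra.
- rewrite in_itv /= => cxy ->; rewrite normrM normrN ler_wpM2r//.
have c2 : 0 <= (r - c) * (r + c) by rewrite mulr_ge0//; lra.
have r2 : 0 < (1 - r) * (1 + r) by rewrite mulr_gt0//; lra.
rewrite ger0_norm ?invr_ge0 ?sqrtr_ge0// lef_pV2 ?posrE ?sqrtr_gt0; try lra.
by rewrite ler_sqrt; lra.
Qed.

Definition clamp (r x : R) : R := Num.max (- r) (Num.min x r).

Lemma clamp_itv (r x : R) : 0 <= r -> -r <= clamp r x <= r.
Proof.
move=> r0; rewrite /clamp le_max lexx /= ge_max ge_min lexx orbT andbT.
by rewrite (le_trans _ r0)// oppr_le0.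
Qed.

Lemma clamp_id (r x : R) : `|x| <= r -> clamp r x = x.
Proof. by rewrite ler_norml /clamp => /andP[rx xr]; rewrite min_l// max_r. Qed.

Lemma clamp_dist_le (r x y : R) : 0 <= r -> `|clamp r x - clamp r y| <= `|x - y|.
Proof.
move=> r0; wlog yx : x y / y <= x.
  move=> H; case/orP: (le_total y x) => /H //.
  by rewrite distrC (distrC y).
rewrite (ger0_norm (_ : 0 <= x - y)) ?subr_ge0// ler_norml /clamp.
by case: (leP x r); case: (leP y r) => ? ?; case: (leP (- r) x) => ?;
  case: (leP (- r) y) => ?; case: (leP (- r) r) => ?; lra.
Qed.

Context (al a be b d : R).

(** Both [P] and [N] have this form: [N] arises from [P] by negating [be] and [d]. *)
Definition level (q : R * R) : R := al * cos (a * q.1) + be * cos (b * q.2) - d.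

(* Clamping the argument of [acos] away from [-1] and [1] makes the graph
   function globally Lipschitz. *)
Lemma level_graph (r : R) : 0 < al -> 0 < a -> 0 <= r < 1 -> exists g : R -> R,
  [/\ lipschitz g, forall y, g (- y) = g y &
   forall q, a * `|q.1| < pi -> `|(d - be * cos (b * q.2)) / al| <= r ->
     0 < level q <-> g q.2 < - `|q.1|].
Proof.
move=> al0 a0 /andP[r0 r1].
pose K y := (d - be * cos (b * y)) / al.
(* Positivity of [level] at [q] reads [a * |q.1| < acos (K q.2)]; the minus signs give the strict
   epigraph form asked of a Lipschitz domain. *)
exists (fun y => - (acos (clamp r (K y)) / a)); split.
- have a1 : 0 <= a^-1 by rewrite invr_ge0 ltW.
  have al1 : 0 <= al^-1 by rewrite invr_ge0 ltW.
  (* The product of the Lipschitz constants of division by [a], of [acos] on [[-r, r]] and of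
     [K]. *)
  pose k := a^-1 * ((Num.sqrt (1 - r ^+ 2))^-1 * (`|be| / al * `|b|)).
  apply: (@klipschitzW _ _ _ k).
    exact: (@globally_properfilter _ _ (0, 0)).
  move=> [x y] _ /=; rewrite -opprD normrN -mulrBl normrM mulrC.
  rewrite (ger0_norm a1) /k -!mulrA ler_wpM2l//.
  apply: (le_trans (acos_dist_le r1 (clamp_itv _ r0) (clamp_itv _ r0))).
  rewrite ler_wpM2l ?invr_ge0 ?sqrtr_ge0//.
  apply: (le_trans (clamp_dist_le _ _ r0)).
  have -> : K x - K y = be / al * (cos (b * y) - cos (b * x)) by rewrite /K; ring.
  rewrite !normrM normfV (gtr0_norm al0) -mulrA !ler_wpM2l//.
  apply: (le_trans (cos_dist_le _ _)).
  by rewrite -mulrBr normrM distrC.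
- by move=> y; rewrite /K mulrN cosN.
- move=> q qpi Kr; rewrite (clamp_id Kr) ltrN2 /level -cos_mul_norm.
  have K1 : -1 <= K q.2 <= 1 by move: Kr; rewrite -/(K q.2) ler_norml; lra.
  rewrite ltr_pdivlMr// (mulrC `|q.1|) -(ltr_cos (y := acos (K q.2))); first last.
  + by rewrite in_itv /= acos_ge0// acos_lepi.
  + by rewrite in_itv /= (mulr_ge0 (ltW a0))//= ltW.
  rewrite acosK ?in_itv// /K ltr_pdivrMr//.
  by split; lra.
Qed.

End InverseCosineGraphs.

(** * Analytic coordinates that straighten level curves *)

Section LevelCharts.
Context {R : realType}.
Context (al a be b d : R).
Local Notation lev := (level al a be b d).

Lemma levelE : lev = trigpoly
  [:: (al, (a, 0), (0, 0)); (be, (0, 0), (b, 0)); (- d, (0, 0), (0, 0))].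
Proof.
apply/funext => q; rewrite /trigpoly !big_cons big_nil /wave /=.
by rewrite !mul0r !addr0 cos0 !mulr1 /level addrA.
Qed.

Lemma continuous_level : continuous lev.
Proof. by rewrite levelE; exact: continuous_trigpoly. Qed.

Lemma analytic_on_level U : analytic_on U lev.
Proof. by move=> p _; rewrite levelE; exact: analytic_at_trigpoly. Qed.

Lemma dx_level q : dx lev q = - (al * a * sin (a * q.1)).
Proof.
rewrite levelE dx_trigpoly /trigpoly /= !big_cons big_nil /wave /=.
by rewrite !(mulr0, mul0r, add0r, addr0) cosDpihalf cos0; ring.
Qed.

Lemma dy_level q : dy lev q = - (be * b * sin (b * q.2)).
Proof.
rewrite levelE dy_trigpoly /trigpoly /= !big_cons big_nil /wave /=.
by rewrite !(mulr0, mul0r, add0r, addr0) cosDpihalf cos0; ring.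
Qed.

(** For positive [a] and [b] this is an open rectangle in which [sin (a * x)] vanishes only at
    [x = 0] and [sin (b * y)] only at [y = 0]. *)
Definition strip : set (R * R) := [set q | a * `|q.1| < pi /\ b * `|q.2| < pi].

(** The sign [e], either [1] or [-1], lets one argument serve both sides of an axis. *)
Definition right_of (e : R) : set (R * R) := [set q | 0 < e * q.1].
Definition above (e : R) : set (R * R) := [set q | 0 < e * q.2].

Lemma open_lt_comp (f : R * R -> R) k : continuous f -> open [set q | f q < k].
Proof.
by move=> cf; apply: (@open_comp _ _ f [set z | z < k]) => // q _; exact: cf.
Qed.

Lemma open_gt_comp (f : R * R -> R) k : continuous f -> open [set q | k < f q].
Proof.
by move=> cf; apply: (@open_comp _ _ f [set z | k < z]) => // q _; exact: cf.
Qed.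

Lemma continuous_mul_fst (e : R) : continuous (fun q : R * R => e * q.1).
Proof. by move=> q; apply: cvgMl_tmp; exact: cvg_fst. Qed.

Lemma continuous_mul_snd (e : R) : continuous (fun q : R * R => e * q.2).
Proof. by move=> q; apply: cvgMl_tmp; exact: cvg_snd. Qed.

Lemma continuous_mul_norm_fst (e : R) : continuous (fun q : R * R => e * `|q.1|).
Proof. by move=> q; apply: cvgMl_tmp; apply: cvg_norm; exact: cvg_fst. Qed.

Lemma continuous_mul_norm_snd (e : R) : continuous (fun q : R * R => e * `|q.2|).
Proof. by move=> q; apply: cvgMl_tmp; apply: cvg_norm; exact: cvg_snd. Qed.

Lemma open_strip : open strip.
Proof.
apply: openI; apply: open_lt_comp.
  exact: continuous_mul_norm_fst.
exact: continuous_mul_norm_snd.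
Qed.

Lemma open_right_of e : open (right_of e).
Proof. exact: (open_gt_comp (@continuous_mul_fst e)). Qed.

Lemma open_above e : open (above e).
Proof. exact: (open_gt_comp (@continuous_mul_snd e)). Qed.

Lemma normr_signed (e x : R) : e = 1 \/ e = -1 -> 0 < e * x -> `|x| = e * x.
Proof.
case=> ->; first by rewrite mul1r => /gtr0_norm.
by rewrite mulN1r oppr_gt0 => /ltr0_norm.
Qed.

Lemma sin_neq0 (k x : R) : 0 < k -> x != 0 -> k * `|x| < pi -> sin (k * x) != 0.
Proof.
move=> k0 x0 kx; have : 0 < sin (k * `|x|).
  by rewrite sin_gt0_pi// kx mulr_gt0// normr_gt0.
case: (ler0P x) => _ s0; last by rewrite gt_eqF.
by rewrite lt_eqF// -oppr_gt0 -sinN -mulrN.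
Qed.

Lemma cos_mul_inj (k e x y : R) : 0 < k -> e = 1 \/ e = -1 ->
  0 < e * x -> 0 < e * y -> k * `|x| < pi -> k * `|y| < pi ->
  cos (k * x) = cos (k * y) -> x = y.
Proof.
move=> k0 e1 ex ey kx ky; rewrite -cos_mul_norm -[RHS]cos_mul_norm.
move=> /cos_inj; rewrite !in_itv /= (ltW kx) (ltW ky) !(mulr_ge0 (ltW k0))// => /(_ isT isT).
move/(mulfI (lt0r_neq0 k0)); rewrite (normr_signed e1 ex) (normr_signed e1 ey).
by apply: mulfI; case: e1 => ->; rewrite ?oppr_eq0 oner_neq0.
Qed.

Lemma dx_fst q : dx (@fst R R) q = 1.
Proof. by have [] := is_derive_fst (is_derive_id q.1 (1 : R)). Qed.

Lemma dy_fst q : dy (@fst R R) q = 0.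
Proof. by have [] := is_derive_fst0 id q. Qed.

Lemma dx_snd q : dx (@snd R R) q = 0.
Proof. by have [] := is_derive_snd0 id q. Qed.

Lemma dy_snd q : dy (@snd R R) q = 1.
Proof. by have [] := is_derive_snd (is_derive_id q.2 (1 : R)). Qed.

(** For fixed [y] the value of [lev] determines [cos (a * x)], hence [x] on one side of the axis.
    The Jacobian is [al * a * sin (a * x)]. *)
Lemma level_chart_right e V : 0 < a -> al != 0 -> e = 1 \/ e = -1 -> open V ->
  analytic_coordinates (V `&` (strip `&` right_of e)) snd lev.
Proof.
move=> a0 al0 e1 oV; split.
- by apply: openI => //; apply: openI; [exact: open_strip|exact: open_right_of].
- by split; [move=> p _; exact: analytic_at_snd|exact: analytic_on_level].
- move=> [x y] [x' y']; rewrite !inE => -[_ [[/= ax _] ex]] [_ [[/= ax' _] ex']].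
  rewrite /level /= => -[<-] /addIr/addIr/(mulfI al0) h.
  by have /= -> := cos_mul_inj a0 e1 ex ex' ax ax' h.
- move=> q [_ [[aq _] eq0]]; rewrite dx_snd dy_snd dx_level mul0r mul1r sub0r opprK.
  rewrite !mulf_neq0 ?(gt_eqF a0)// sin_neq0//.
  by apply: contraTneq eq0 => ->; rewrite mulr0 ltxx.
Qed.

Lemma level_chart_above e V : 0 < b -> be != 0 -> e = 1 \/ e = -1 -> open V ->
  analytic_coordinates (V `&` (strip `&` above e)) fst lev.
Proof.
move=> b0 be0 e1 oV; split.
- by apply: openI => //; apply: openI; [exact: open_strip|exact: open_above].
- by split; [move=> p _; exact: analytic_at_fst|exact: analytic_on_level].
- move=> [x y] [x' y']; rewrite !inE => -[_ [[/= _ bx] ex]] [_ [[/= _ bx'] ex']].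
  rewrite /level /= => -[<-] /addIr/addrI/(mulfI be0) h.
  by have /= -> := cos_mul_inj b0 e1 ex ex' bx bx' h.
- move=> q [_ [[_ bq] eq0]]; rewrite dx_fst dy_fst dy_level mul0r mul1r subr0.
  rewrite oppr_eq0 !mulf_neq0 ?(gt_eqF b0)// sin_neq0//.
  by apply: contraTneq eq0 => ->; rewrite mulr0 ltxx.
Qed.

End LevelCharts.

(** * The cell of a positive level function around the origin, as a domain *)

Section Ovals.
Context {R : realType}.
Context (al a be b d : R).
Local Notation lev := (level al a be b d).
Local Notation strip := (strip a b).

Definition oval : set (R * R) := strip `&` [set q | 0 < lev q].

Context (al_gt0 : 0 < al) (a_gt0 : 0 < a) (be_gt0 : 0 < be) (b_gt0 : 0 < b).
(** These make [lev] negative on the vertical and on the horizontal sides of the rectangle; the next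
    condition makes it positive at the origin. *)
Context (level_x_lt0 : be < al + d) (level_y_lt0 : al < be + d).
Context (level0_gt0 : d < al + be).

Lemma open_oval : open oval.
Proof.
apply: openI; first exact: open_strip.
exact: open_gt_comp (@continuous_level _ al a be b d).
Qed.

Lemma ltr_cos_mul_norm (k x y : R) : 0 < k -> k * `|y| <= pi -> `|x| < `|y| ->
  cos (k * y) < cos (k * x).
Proof.
move=> k0 yp xy; rewrite -(cos_mul_norm k x) -(cos_mul_norm k y) ltr_cos.
- by rewrite ltr_pM2l.
- rewrite in_itv /= (mulr_ge0 (ltW k0))//= (le_trans _ yp)//.
  by rewrite ler_pM2l// ltW.
- by rewrite in_itv /= (mulr_ge0 (ltW k0)).
Qed.

Lemma ler_cos_mul_norm (k x y : R) : 0 < k -> k * `|y| <= pi -> `|x| <= `|y| ->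
  cos (k * y) <= cos (k * x).
Proof.
move=> k0 yp; rewrite le_eqVlt => /orP[/eqP xy|/(ltr_cos_mul_norm k0 yp)/ltW//].
by rewrite -(cos_mul_norm k x) -(cos_mul_norm k y) xy.
Qed.

Lemma strip_le (p q : R * R) : strip p -> `|q.1| <= `|p.1| -> `|q.2| <= `|p.2| ->
  strip q.
Proof.
move=> [p1 p2] q1 q2; split.
  by apply: le_lt_trans p1; rewrite ler_pM2l.
by apply: le_lt_trans p2; rewrite ler_pM2l.
Qed.

Lemma level_le (p q : R * R) : strip p -> `|q.1| <= `|p.1| -> `|q.2| <= `|p.2| ->
  lev p <= lev q.
Proof.
move=> [p1 p2] q1 q2; rewrite lerB// lerD//.
  by rewrite ler_pM2l// ler_cos_mul_norm// ltW.
by rewrite ler_pM2l// ler_cos_mul_norm// ltW.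
Qed.

(** On the rectangle [lev] is nonincreasing in both absolute values. Convexity in [x], symmetry and
    star-shapedness all come from this. *)
Lemma oval_le (p q : R * R) : oval p -> `|q.1| <= `|p.1| -> `|q.2| <= `|p.2| ->
  oval q.
Proof.
move=> [sp lp] q1 q2; split; first exact: (strip_le sp).
exact: lt_le_trans lp (level_le sp q1 q2).
Qed.

Lemma oval0 : oval (0, 0).
Proof.
split; first by split; rewrite /= normr0 mulr0 pi_gt0.
by rewrite /= /level /= !mulr0 cos0 !mulr1 subr_gt0.
Qed.

Lemma convex_in_x_oval : convex_in_x oval.
Proof.
move=> x1 x2 y o1 o2 x /andP[x1x xx2].
have [x0|x0] := leP 0 x.
  by apply: (oval_le o2) => //=; rewrite !ger0_norm// (le_trans x0).
apply: (oval_le o1) => //=.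
by rewrite !ltr0_norm// ?lerN2// (le_lt_trans x1x).
Qed.

Lemma symmetric_about_H0_oval : symmetric_about_H0 oval.
Proof. by move=> x y oxy; apply: (oval_le oxy); rewrite /= ?normrN. Qed.

Lemma continuous_ray (p : R * R) : continuous (fun t : R => (t * p.1, t * p.2)).
Proof.
move=> t; apply: (cvg_pair (F := nbhs t) (G := nbhs (t * p.1))
  (H := nbhs (t * p.2)) (f := fun s => s * p.1) (g := fun s => s * p.2)).
  exact: (cvgMr_tmp (f := id) cvg_id).
exact: (cvgMr_tmp (f := id) cvg_id).
Qed.

Lemma normr_ray_le (t x : R) : 0 <= t <= 1 -> `|t * x| <= `|x|.
Proof. by move=> /andP[t0 t1]; rewrite normrM (ger0_norm t0) ler_piMl. Qed.

(** The cell is star-shaped: it is the union of the segments from the origin to its points. *)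
Lemma connected_oval : connected oval.
Proof.
rewrite [oval](_ : _ = \bigcup_(p in oval)
    ((fun t : R => (t * p.1, t * p.2)) @` `[0, 1])).
  apply: bigcup_connected.
    exists (0, 0) => p _ /=; exists 0; last by rewrite !mul0r.
    by rewrite /= in_itv /= lexx ler01.
  move=> p _; apply: connected_continuous_connected.
    exact: segment_connected.
  by apply: continuous_subspaceT; exact: continuous_ray.
apply/seteqP; split=> [p op|q [p op [t]]].
  exists p => //; exists 1; first by rewrite /= in_itv /= ler01 lexx.
  by rewrite !mul1r; case: p {op}.
rewrite /= in_itv /= => t01 <-.
by apply: (oval_le op); exact: normr_ray_le.
Qed.

Lemma bounded_oval : bounded_set oval.
Proof.
exists (pi / a + pi / b); split; first exact: num_real.
move=> M /ltW HM p [[p1 p2] _] /=; apply: le_trans HM.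
have pa : 0 <= pi / a by rewrite divr_ge0 ?pi_ge0// ltW.
have pb : 0 <= pi / b by rewrite divr_ge0 ?pi_ge0// ltW.
rewrite prod_normE ge_max; apply/andP; split.
  by rewrite ler_wpDr// ler_pdivlMr// mulrC ltW.
by rewrite ler_wpDl// ler_pdivlMr// mulrC ltW.
Qed.

(** At a limit point [lev] is nonnegative, whereas it is negative on the sides of the rectangle. *)
Lemma closure_oval_sub p : closure oval p -> strip p /\ 0 <= lev p.
Proof.
pose C := [set q : R * R | a * `|q.1| <= pi] `&` [set q | b * `|q.2| <= pi] `&`
  [set q | 0 <= lev q].
have cC : closed C.
  apply: closedI; first apply: closedI.
  - apply: (@closed_comp _ _ (fun q : R * R => a * `|q.1|) [set z | z <= pi]).
      by move=> q _; exact: continuous_mul_norm_fst.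
    exact: closed_le.
  - apply: (@closed_comp _ _ (fun q : R * R => b * `|q.2|) [set z | z <= pi]).
      by move=> q _; exact: continuous_mul_norm_snd.
    exact: closed_le.
  - apply: (@closed_comp _ _ lev [set z | 0 <= z]).
      by move=> q _; exact: continuous_level.
    exact: closed_ge.
have oC : oval `<=` C by move=> q [[q1 q2] lq]; split; [split|]; apply: ltW.
move=> /(closureS oC); rewrite -(closure_id C).1// => -[[/= p1 p2] lp].
have [cx cy] : cos (a * p.1) <= 1 /\ cos (b * p.2) <= 1 by rewrite !cos_le1.
have {cy} by1 : be * cos (b * p.2) <= be by rewrite ler_piMr// ltW.
have {cx} ax1 : al * cos (a * p.1) <= al by rewrite ler_piMr// ltW.
have {}lp : d <= al * cos (a * p.1) + be * cos (b * p.2) by rewrite -subr_ge0.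
split; last by rewrite subr_ge0.
split; rewrite lt_neqAle ?p1 ?p2 andbT; apply/eqP => e.
  by move: level_x_lt0 lp ax1; rewrite -cos_mul_norm e cospi; lra.
by move: level_y_lt0 lp by1; rewrite -(cos_mul_norm b) e cospi; lra.
Qed.

(** A zero of [lev] is approached from inside along its ray, since shrinking it towards the origin
    strictly increases [lev]. *)
Lemma boundary_oval : boundary oval = strip `&` [set q | lev q = 0].
Proof.
rewrite /boundary ((interior_id oval).1 open_oval).
apply/seteqP; split=> [p [/closure_oval_sub[sp lp] op]|p [sp lp]].
  split=> //=; apply/eqP; rewrite eq_le lp andbT leNgt.
  by apply/negP => l0; apply: op.
split; last by case=> _; rewrite /= lp ltxx.
move=> B pB.
have : \forall t \near (1 : R)^'-, B (t * p.1, t * p.2).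
  have := @continuous_ray p 1 B; rewrite /= !mul1r -surjective_pairing => /(_ pB).
  move=> nB; rewrite near_withinE.
  by apply: (@filterS _ (nbhs (1 : R)) _ (fun t : R => B (t * p.1, t * p.2))).
move=> nB.
have [t [[Bt t0] t1]] : exists t, (B (t * p.1, t * p.2) /\ 0 < t) /\ t < 1.
  apply: (@filter_ex _ (1 : R)^'-).
  apply: filterI; last exact: nbhs_left_lt.
  by apply: filterI => //; exact: nbhs_left_gt.
exists (t * p.1, t * p.2); split=> //.
have t01 : 0 <= t <= 1 by rewrite !ltW.
split; first by apply: (strip_le sp); exact: normr_ray_le.
have lt_ray x : x != 0 -> `|t * x| < `|x|.
  by move=> x0; rewrite normrM (gtr0_norm t0) gtr_pMl ?normr_gt0.
case: sp => p1 p2; rewrite /= -[ltLHS]lp /level ltrD2r /=.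
have le1 : al * cos (a * p.1) <= al * cos (a * (t * p.1)).
  by rewrite ler_pM2l// ler_cos_mul_norm ?normr_ray_le// ltW.
have le2 : be * cos (b * p.2) <= be * cos (b * (t * p.2)).
  by rewrite ler_pM2l// ler_cos_mul_norm ?normr_ray_le// ltW.
(* Strictness comes from a nonzero coordinate; both cannot vanish, as [lev] is positive at the
   origin. *)
have [x0|x0] := eqVneq p.1 0; last first.
  apply: ltr_leD le2; rewrite ltr_pM2l// ltr_cos_mul_norm ?lt_ray//.
  exact: ltW.
have [y0|y0] := eqVneq p.2 0.
  by move: lp level0_gt0; rewrite /= /level x0 y0 !mulr0 cos0; lra.
apply: ler_ltD le1 _; rewrite ltr_pM2l// ltr_cos_mul_norm ?lt_ray//.
exact: ltW.
Qed.

Lemma neq0_sign (x : R) : x != 0 -> exists2 e : R, e = 1 \/ e = -1 & 0 < e * x.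
Proof.
rewrite neq_lt => /orP[x0|x0].
  by exists (-1); [right|rewrite mulN1r oppr_gt0].
by exists 1; [left|rewrite mul1r].
Qed.

Lemma oval_boundary_neq0 p : boundary oval p -> p.1 != 0 \/ p.2 != 0.
Proof.
rewrite boundary_oval => -[_ /= lp].
have [x0|] := eqVneq p.1 0; last by left.
have [y0|] := eqVneq p.2 0; last by right.
by move: lp level0_gt0; rewrite /level x0 y0 !mulr0 cos0; lra.
Qed.

(** A boundary point has a nonzero coordinate; the other coordinate and [lev] form a chart there. *)
Lemma analytic_submanifold1_boundary_oval : analytic_submanifold1 (boundary oval).
Proof.
move=> p bp; have := oval_boundary_neq0 bp; move: bp; rewrite boundary_oval.
move=> [sp lp] [/neq0_sign[e e1 ep]|/neq0_sign[e e1 ep]].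
- exists (setT `&` (strip `&` right_of e)), snd, lev; split=> //.
    by apply: level_chart_right; rewrite ?gt_eqF//; exact: openT.
  rewrite setTI; apply/seteqP; split=> q; first by case=> [[sq lq] [_ eq]].
  by case=> [[sq eq] lq].
- exists (setT `&` (strip `&` above e)), fst, lev; split=> //.
    by apply: level_chart_above; rewrite ?gt_eqF//; exact: openT.
  rewrite setTI; apply/seteqP; split=> q; first by case=> [[sq lq] [_ eq]].
  by case=> [[sq eq] lq].
Qed.

Lemma norm_cos_lt1 (k x : R) : 0 < k -> x != 0 -> k * `|x| < pi -> `|cos (k * x)| < 1.
Proof.
move=> k0 x0 kx; rewrite lt_neqAle cos_max andbT norm_cos_eq1.
exact: sin_neq0.
Qed.

Lemma continuous_norm_cos_ratio (f : R * R -> R) (m n k : R) : continuous f ->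
  continuous (fun q => `|(d - m * cos (n * f q)) / k|).
Proof.
move=> cf q; apply: cvg_norm; apply: cvgMr_tmp; apply: cvgB; first exact: cvg_cst.
apply: cvgMl_tmp; apply: (@continuous_comp _ _ _ (fun q => n * f q) (@cos R)).
  by apply: cvgMl_tmp; exact: cf.
exact: continuous_cos.
Qed.

Lemma midpoint_lt1 (K : R) : 0 <= K < 1 -> 0 <= (1 + K) / 2 < 1 /\ K < (1 + K) / 2.
Proof. by lra. Qed.

Lemma lipschitz_domain_oval : lipschitz_domain oval.
Proof.
split; first by split; [exact: open_oval|exists (0, 0); exact: oval0|exact: connected_oval].
move=> p bp; have := oval_boundary_neq0 bp; move: bp; rewrite boundary_oval.
move=> [sp lp] [x0|y0].
- have [e e1 ep] := neq0_sign x0.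
  (* On the level curve [K] equals the size of [cos (a * x)], which is below 1 at [p] because [x] is
     nonzero. The midpoint of [K p] and 1 serves as clamping bound, so the clamp is inactive near
     [p]. *)
  pose K (q : R * R) := `|(d - be * cos (b * q.2)) / al|.
  have Kp : 0 <= K p < 1.
    rewrite /K normr_ge0 [X in X / al](_ : _ = cos (a * p.1) * al); last first.
      by move: lp; rewrite /= /level; lra.
    by rewrite mulfK ?gt_eqF// norm_cos_lt1//; case: sp.
  have [r01 Kr] := midpoint_lt1 Kp.
  have [g [lg eg Hg]] := @level_graph R al a be b d ((1 + K p) / 2) al_gt0 a_gt0 r01.
  (* A quarter turn with sine [e]: the graph variable is [e * q.2], harmless as [g] is even, and the
     height is [- e * q.1], the negated absolute value of [q.1]. *)
  exists ((strip `&` right_of e) `&` [set q | K q < (1 + K p) / 2]), 0, e, g.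
  split=> //.
  + apply: openI; first by apply: openI; [exact: open_strip|exact: open_right_of].
    by apply: open_lt_comp; apply: continuous_norm_cos_ratio => q; exact: cvg_snd.
  + by case: e1 => ->; rewrite expr0n add0r ?sqrrN expr1n.
  + have H q : right_of e q -> g (0 * q.1 + e * q.2) = g q.2.
      by move=> _; rewrite mul0r add0r; case: e1 => ->; rewrite ?mul1r// mulN1r eg.
    apply/seteqP; split=> q.
      move=> [[_ lq] [[sq eq] Kq]]; split=> //=.
      rewrite H// mul0r addr0 mulNr -(normr_signed e1 eq).
      exact: (Hg q sq.1 (ltW Kq)).1.
    move=> [[[sq eq] Kq] /=].
    rewrite H// mul0r addr0 mulNr -(normr_signed e1 eq) => gq.
    by split=> //; split=> //; apply: (Hg q sq.1 (ltW Kq)).2.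
(* The same with the coordinates exchanged; the rotation is now by 0 or [pi]. *)
- have [e e1 ep] := neq0_sign y0.
  pose K (q : R * R) := `|(d - al * cos (a * q.1)) / be|.
  have Kp : 0 <= K p < 1.
    rewrite /K normr_ge0 [X in X / be](_ : _ = cos (b * p.2) * be); last first.
      by move: lp; rewrite /= /level; lra.
    by rewrite mulfK ?gt_eqF// norm_cos_lt1//; case: sp.
  have [r01 Kr] := midpoint_lt1 Kp.
  have [g [lg eg Hg]] := @level_graph R be b al a d ((1 + K p) / 2) be_gt0 b_gt0 r01.
  have levelC q : level be b al a d (q.2, q.1) = lev q.
    by rewrite /level /= (addrC (be * _)).
  exists ((strip `&` above e) `&` [set q | K q < (1 + K p) / 2]), (- e), 0, g.
  split=> //.
  + apply: openI; first by apply: openI; [exact: open_strip|exact: open_above].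
    by apply: open_lt_comp; apply: continuous_norm_cos_ratio => q; exact: cvg_fst.
  + by case: e1 => ->; rewrite expr0n addr0 ?sqrrN expr1n.
  + have H q : above e q -> g (- e * q.1 + 0 * q.2) = g q.1.
      move=> _; rewrite mul0r addr0.
      by case: e1 => ->; rewrite ?opprK ?mul1r// mulN1r eg.
    apply/seteqP; split=> q.
      move=> [[_ lq] [[sq eq] Kq]]; split=> //=.
      rewrite H// oppr0 mul0r add0r mulNr -(normr_signed e1 eq).
      by apply: (Hg (q.2, q.1) sq.2 (ltW Kq)).1; rewrite levelC.
    move=> [[[sq eq] Kq] /=].
    rewrite H// oppr0 mul0r add0r mulNr -(normr_signed e1 eq) => gq.
    split=> //; split=> //=; rewrite -levelC.
    by apply: (Hg (q.2, q.1) sq.2 (ltW Kq)).2.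
Qed.

End Ovals.

(** * The explicit solution: equation, boundary values and sign *)

Section Example.
Context {R : realType}.
Implicit Types (q : R * R) (e y : R).

(** The squares solve [16 kx^2 + ky^2 = 4] and [4 kx^2 + 25 ky^2 = 4], which give both waves of
    [x_modes] the eigenvalue 4. *)
Definition kx : R := Num.sqrt (8 / 33).
Definition ky : R := Num.sqrt (4 / 33).
(** With this amplitude [(s10 c)^2] has mean 5 in [x], the constant in
    [cos s (E^2 - 5) = 4 cos (5 s)]. *)
Definition s10 : R := Num.sqrt 10.

Local Notation P := (level s10 kx 4 (2 * ky) 1).
Local Notation N := (level s10 kx (-4) (2 * ky) (-1)).
Local Notation Om := (oval s10 kx 4 (2 * ky) 1).

Lemma kx_gt0 : 0 < kx. Proof. by rewrite sqrtr_gt0 divr_gt0. Qed.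
Lemma ky_gt0 : 0 < ky. Proof. by rewrite sqrtr_gt0 divr_gt0. Qed.
Lemma kx_sqr : kx ^+ 2 = 8 / 33. Proof. by rewrite sqr_sqrtr// divr_ge0. Qed.
Lemma ky_sqr : ky ^+ 2 = 4 / 33. Proof. by rewrite sqr_sqrtr// divr_ge0. Qed.
Lemma s10_sqr : s10 ^+ 2 = 10. Proof. by rewrite sqr_sqrtr. Qed.

Lemma s10_itv : 3 < s10 < 5.
Proof.
have s0 : 0 <= s10 by rewrite sqrtr_ge0.
apply/andP; split; rewrite ltNge; apply/negP => h; have := s10_sqr.
  have : s10 ^+ 2 <= 3 ^+ 2 by rewrite lerXn2r ?nnegrE.
  by move=> + E; rewrite E; lra.
have : 5 ^+ 2 <= s10 ^+ 2 by rewrite lerXn2r ?nnegrE.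
by move=> + E; rewrite E; lra.
Qed.

Lemma s10_gt0 : 0 < s10. Proof. by have := s10_itv; lra. Qed.
Lemma ky2_gt0 : 0 < 2 * ky. Proof. by rewrite mulr_gt0 ?ky_gt0. Qed.
Lemma lt_4_s10D1 : 4 < s10 + 1. Proof. by have := s10_itv; lra. Qed.
Lemma lt_s10_4D1 : s10 < 4 + 1. Proof. by have := s10_itv; lra. Qed.
Lemma lt_1_s10D4 : 1 < s10 + 4. Proof. by have := s10_itv; lra. Qed.
Lemma four_gt0 : 0 < 4 :> R. Proof. by []. Qed.

Definition x_modes : seq (R * (R * R) * (R * R)) :=
  [:: (25 / 2, (4 * kx, 0), (ky, 0)); (-40, (2 * kx, 0), (5 * ky, 0))].

(** The expansion of [cos s (25/2 + (5 - E^2)^2)], the part of [u] that is independent of [x]. *)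
Definition y_modes : seq (R * (R * R) * (R * R)) :=
  [:: (16, (0, 0), (9 * ky, 0)); (-16, (0, 0), (7 * ky, 0));
      (16, (0, 0), (5 * ky, 0)); (-16, (0, 0), (3 * ky, 0));
      (57 / 2, (0, 0), (ky, 0))].

Definition usol : R * R -> R := trigpoly (x_modes ++ y_modes).

(** On a wave of frequency [k] in [y] alone, minus the operator [Delta + 4] multiplies by [k^2 - 4].
    The abscissa 0 is arbitrary. *)
Definition hsol y : R := trigpoly
  [seq (m.1.1 * (m.2.1 ^+ 2 - 4), m.1.2, m.2) | m <- y_modes] (0, y).

(** The Chebyshev recurrence; it turns the factorization of [usol] into a polynomial identity in
    [cos (kx x)] and [cos (ky y)]. *)
Lemma cos_rec (n : nat) (x : R) :
  cos (n.+2%:R * x) = 2 * cos x * cos (n.+1%:R * x) - cos (n%:R * x).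
Proof.
have -> : n.+2%:R * x = n.+1%:R * x + x by rewrite [in LHS]mulrS; ring.
have -> : n%:R * x = n.+1%:R * x - x by rewrite [in RHS]mulrS; ring.
by rewrite cosD cosB; ring.
Qed.

Lemma usol_factored q : usol q = cos (ky * q.2) * (P q * N q) ^+ 2.
Proof.
have PN : P q * N q = 10 * cos (kx * q.1) ^+ 2 - (4 * cos (2 * ky * q.2) - 1) ^+ 2.
  by rewrite -s10_sqr /level; ring.
rewrite PN /usol /trigpoly !big_cons big_nil /wave /= !(mul0r, addr0) cos0 -!mulrA.
rewrite !(cos_rec, mulr1n, mulr0n, mul1r, mul0r, cos0).
by field.
Qed.

Lemma continuous_hsol : continuous hsol.
Proof.
move=> y; apply: (@continuous_comp _ _ _ (fun z : R => ((0 : R), z))).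
  apply: (cvg_pair (F := nbhs y) (G := nbhs (0 : R)) (H := nbhs y)
    (f := fun=> 0) (g := id)); first exact: cvg_cst.
  exact: cvg_id.
exact: continuous_trigpoly.
Qed.

(** The waves of [x_modes] cancel against the term [4 u]; each wave of [y_modes] is compensated by
    its term in [hsol]. *)
Lemma usol_equation q : laplacian usol q + 4 * usol q + hsol q.2 = 0.
Proof.
rewrite /usol laplacian_trigpoly /hsol /trigpoly /= !big_cons !big_nil /wave /=.
rewrite !exprMn kx_sqr ky_sqr !(mul0r, addr0).
by field.
Qed.

Lemma classical_solution_usol : classical_solution hsol Om usol.
Proof.
split.
- exact: C2_on_trigpoly.
- by apply: continuous_subspaceT; exact: continuous_trigpoly.
- by move=> q _; exact: usol_equation.
- move=> q; rewrite (boundary_oval s10_gt0 kx_gt0 four_gt0 ky2_gt0 lt_4_s10D1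
    lt_s10_4D1 lt_1_s10D4).
  by move=> [_ /= Pq]; rewrite usol_factored Pq mul0r expr0n mulr0.
Qed.

(** The rectangle has half-height [pi / (2 ky)], which keeps [ky y] within [pi / 2] of 0. *)
Lemma cos_ky_gt0 q : Om q -> 0 < cos (ky * q.2).
Proof.
move=> [[_ yq] _]; rewrite -cos_mul_norm; apply: cos_gt0_pihalf.
have : 0 <= ky * `|q.2| by rewrite mulr_ge0// ltW ?ky_gt0.
by move: yq (pi_gt0 R); rewrite -mulrA; lra.
Qed.

Lemma usol_ge0 q : Om q -> 0 <= usol q.
Proof. by move=> /cos_ky_gt0 /ltW c0; rewrite usol_factored mulr_ge0// sqr_ge0. Qed.

(** * The nodal set as a pair of analytic arcs *)

Definition branch e : set (R * R) := Om `&` (right_of e `&` [set q | N q = 0]).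

Lemma nodal_set_usol : nodal_set Om usol = branch 1 `|` branch (-1).
Proof.
apply/seteqP; split=> q; last first.
  by case=> -[oq [_ /= Nq]]; split=> //=; rewrite usol_factored Nq mulr0 expr0n mulr0.
move=> [oq /= /eqP]; rewrite usol_factored mulf_eq0 sqrf_eq0 mulf_eq0.
have [_ /= Pq] := oq; rewrite (gt_eqF Pq) (gt_eqF (cos_ky_gt0 oq)) => /eqP Nq.
(* On the axis [N] is at least [s10 - 3 > 0], so its zeros lie on either side. *)
have /neq0_sign[e [->|->] eq] : q.1 != 0.
  apply/eqP => q0; move: Nq; rewrite /level q0 mulr0 cos0.
  by have := cos_le1 (2 * ky * q.2); have := s10_itv; lra.
by left; split.
by right; split.
Qed.

(** On [N = 0] one has [P = 2 E], so the condition [E > 0] expresses the positivity of [P]. *)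
Definition heights : set R := [set y | 2 * ky * `|y| < pi /\ 1 < 4 * cos (2 * ky * y)].

Definition branch_point e y : R * R :=
  (e * (acos ((4 * cos (2 * ky * y) - 1) / s10) / kx), y).

Lemma heights_itv y : heights y -> 0 < (4 * cos (2 * ky * y) - 1) / s10 < 1.
Proof.
move=> [_ y1]; have c1 := cos_le1 (2 * ky * y); have s := s10_itv.
by rewrite ltr_pdivrMr ?divr_gt0 ?s10_gt0//; lra.
Qed.

Lemma connected_heights : connected heights.
Proof.
apply/connected_intervalP => x y hx hy z /andP[xz zy].
have le_heights t s : heights t -> `|s| <= `|t| -> heights s.
  move=> [t1 t2] st; split.
    by apply: le_lt_trans t1; rewrite ler_pM2l ?ky2_gt0.
  apply: (lt_le_trans t2); rewrite ler_pM2l//.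
  by apply: ler_cos_mul_norm => //; [exact: ky2_gt0|exact: ltW].
have [z0|z0] := leP 0 z.
  by apply: (le_heights y) => //=; rewrite !ger0_norm// (le_trans z0).
apply: (le_heights x) => //=.
by rewrite !ltr0_norm// ?lerN2// (le_lt_trans xz).
Qed.

(** Parametrization by height, from which the arc is seen to be nonempty and connected. *)
Lemma branchE e : e = 1 \/ e = -1 -> branch e = branch_point e @` heights.
Proof.
move=> e1; have e2 : e * e = 1 by case: e1 => ->; rewrite ?mulrNN mulr1.
apply/seteqP; split=> [q [[[sx sy] /= Pq] [eq /= Nq]]|_ [y hy <-]].
  have cE : cos (kx * q.1) = (4 * cos (2 * ky * q.2) - 1) / s10.
    apply: (mulfI (lt0r_neq0 s10_gt0)); rewrite mulrCA divff ?gt_eqF ?s10_gt0//.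
    by move: Nq; rewrite /level; lra.
  exists q.2.
    by split=> //; move: Pq Nq; rewrite /level; lra.
  rewrite /branch_point -cE -cos_mul_norm cosK; last first.
    by rewrite in_itv /= (ltW sx) mulr_ge0// ltW ?kx_gt0.
  rewrite mulrAC divff ?gt_eqF ?kx_gt0// mul1r (normr_signed e1 eq) mulrA e2 mul1r.
  by rewrite -surjective_pairing.
have Ey := heights_itv hy.
set E := (4 * cos (2 * ky * y) - 1) / s10 in Ey *.
have E1 : -1 <= E < 1 by lra.
have a0 : 0 < acos E by rewrite acos_gt0.
have ap : acos E < pi by rewrite acos_ltpi//; lra.
have kE : kx * (acos E / kx) = acos E.
  by rewrite mulrCA divff ?gt_eqF ?kx_gt0// mulr1.
have cE : cos (kx * (e * (acos E / kx))) = E.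
  case: e1 => ->; rewrite ?mul1r ?mulN1r ?mulrN ?cosN kE acosK// in_itv /=.
    by lra.
  by lra.
have pos : 0 < e * (e * (acos E / kx)).
  by rewrite mulrA e2 mul1r divr_gt0 ?kx_gt0.
have sE : s10 * E = 4 * cos (2 * ky * y) - 1.
  by rewrite mulrCA divff ?gt_eqF ?s10_gt0// mulr1.
case: hy => hy1 hy2.
split; first split; first split => //=.
- by rewrite (normr_signed e1 pos) (mulrA e) e2 mul1r kE.
- by rewrite /= /level /= cE sE; lra.
- by split; last by rewrite /= /level /= cE sE; lra.
Qed.

Lemma analytic_curve_branch e : e = 1 \/ e = -1 -> analytic_curve (branch e).
Proof.
move=> e1; split.
- rewrite branchE//; exists (branch_point e 0), 0 => //; split.
    by rewrite normr0 mulr0 pi_gt0.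
  by rewrite mulr0 cos0; lra.
- rewrite branchE//; apply: connected_continuous_connected.
    exact: connected_heights.
  apply: continuous_in_subspaceT => y; rewrite inE => /heights_itv hy.
  apply: (cvg_pair (F := nbhs y) (G := nbhs (branch_point e y).1) (H := nbhs y)
    (f := fun z => (branch_point e z).1) (g := id)); last exact: cvg_id.
  apply: cvgMl_tmp; apply: cvgMr_tmp.
  apply: (@continuous_comp _ _ _ (fun z => (4 * cos (2 * ky * z) - 1) / s10)).
    apply: cvgMr_tmp; apply: cvgB; last exact: cvg_cst.
    apply: cvgMl_tmp; apply: (@continuous_comp _ _ _ (fun z => 2 * ky * z) (@cos R)).
      exact: (cvgMl_tmp (g := id) cvg_id).
    exact: continuous_cos.
  by apply: continuous_acos; lra.
(* The height and [N] straighten the arc at each of its points; it has no end point in the open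
   cell, hence the alternative [left] below. *)
- move=> p bp; exists (Om `&` (strip kx (2 * ky) `&` right_of e)), snd, N.
  have [[sp Pp] [ep Np]] := bp; split=> //.
    apply: level_chart_right; rewrite ?gt_eqF ?s10_gt0 ?kx_gt0//.
    exact: open_oval.
  left; apply/seteqP; split=> q.
    by move=> [[oq [eq Nq]] oU].
  by move=> [[oq [sq eq]] Nq].
Qed.

(** The branches lie in opposite open half-planes, neither of which meets the closure of the
    other. *)
Lemma separated_branches : separated (branch 1) (branch (-1)).
Proof.
have disj e q : closure (branch e) q -> branch (- e) q -> False.
  move=> cq [_ [eq _]].
  have [] := cq (right_of (- e)).
    by apply: open_nbhs_nbhs; split => //; exact: open_right_of.
  move=> z [[_ [ez _]]]; move: ez; rewrite /right_of /= mulNr oppr_gt0.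
  by move=> /ltW /le_gtF ->.
split; apply/seteqP; split=> // q []; first exact: disj.
by move=> b1 cb; apply: disj cb _; rewrite opprK.
Qed.

End Example.

Theorem theorem1p1 (R : realType) :
  exists (h : R -> R) (Om : set (R * R)),
    [/\ continuous h,
        bounded_set Om,
        analytic_domain Om,
        convex_in_x Om &
        symmetric_about_H0 Om] /\
    exists u : R * R -> R,
      [/\ classical_solution h Om u,
          (forall p, Om p -> 0 <= u p) &
          consists_of_two_analytic_curves (nodal_set Om u)].
Proof.
exists hsol, (oval s10 kx 4 (2 * ky) 1); split.
  split.
  - exact: continuous_hsol.
  - exact: bounded_oval kx_gt0 ky2_gt0.
  - split.
      exact: lipschitz_domain_oval s10_gt0 kx_gt0 four_gt0 ky2_gt0 lt_4_s10D1
        lt_s10_4D1 lt_1_s10D4.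
    exact: analytic_submanifold1_boundary_oval s10_gt0 kx_gt0 four_gt0 ky2_gt0
      lt_4_s10D1 lt_s10_4D1 lt_1_s10D4.
  - exact: convex_in_x_oval s10_gt0 kx_gt0 four_gt0 ky2_gt0.
  - exact: symmetric_about_H0_oval s10_gt0 kx_gt0 four_gt0 ky2_gt0.
exists usol; split.
- exact: classical_solution_usol.
- exact: usol_ge0.
- exists (branch 1), (branch (-1)); split.
  + by apply: analytic_curve_branch; left.
  + by apply: analytic_curve_branch; right.
  + exact: separated_branches.
  + exact: nodal_set_usol.
Qed.
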